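(* Let $p\le q$ and let $(K_{p,q},\sigma)$ be a signed complete bipartite graph with bipartition $(U_p,V_q)$, $U_p=\{u_1,\dots,u_p\}$, $V_q=\{v_1,\dots,v_q\}$. Let $U_r\subseteq U_p$ and $V_s\subseteq V_q$ with $|U_r|=r\le p$, $|V_s|=s\le q$ be such that the induced signed subgraph $(K_{p,q},\sigma)[U_r\cup V_s]$ contains all negative edges of $(K_{p,q},\sigma)$, and such that $r+s$ is minimum among all vertex sets of this form with this property. Then the multiplicity $m(0)$ of the eigenvalue $0$ of $(K_{p,q},\sigma)$ satisfies $m(0)\ge p+q-2k-2$, where $k=\min(r,s)$.
   Context: A signed graph $\Gamma=(G,\sigma)$ consists of a simple graph $G$ and a sign function $\sigma:E(G)\to\{-1,1\}$; edges with sign $-1$ are negative, those with sign $+1$ positive. Its adjacency matrix $A(\Gamma)=(a^\sigma_{ij})$ has $a^\sigma_{ij}=\sigma(v_iv_j)$ if $v_iv_j\in E(G)$ and $0$ otherwise. The eigenvalues (spectrum) of $\Gamma$ are those of $A(\Gamma)$, counted with multiplicity; $m(\lambda)$ denotes the multiplicity of eigenvalue $\lambda$. For $X\subseteq V(G)$, $\Gamma[X]$ is the induced signed subgraph on $X$ with the restricted sign function. $K_{p,q}$ is the complete bipartite graph with parts of sizes $p$ and $q$. *)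

(* Defs.v *)
From mathcomp Require Import all_boot all_order all_algebra.

Set Implicit Arguments.
Unset Strict Implicit.
Unset Printing Implicit Defensive.

Import Order.TTheory GRing.Theory Num.Theory.

Local Open Scope ring_scope.

Record sgraph (T : finType) := SGraph {
  adj : rel T;
  adj_sym : symmetric adj;
  adj_irr : irreflexive adj
}.

(* An edge is an unordered pair, so the sign is a symmetric function of its
   two ends; its values on non-adjacent pairs are irrelevant. *)
Record signed_graph (T : finType) := SignedGraph {
  ground : sgraph T;
  sgn : T -> T -> int;
  sgn_sym : forall x y, adj ground x y -> sgn x y = sgn y x;
  sgn_pm1 : forall x y, adj ground x y -> sgn x y = -1 \/ sgn x y = 1
}.

Definition neg_edge (T : finType) (S : signed_graph T) (x y : T) : bool :=
  adj (ground S) x y && (sgn S x y == -1).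

Definition adjacency (T : finType) (R : pzRingType) (S : signed_graph T) : 'M[R]_#|T| :=
  \matrix_(i, j) (if adj (ground S) (enum_val i) (enum_val j)
                  then (sgn S (enum_val i) (enum_val j))%:~R else 0).

(* Algebraic multiplicity; it is 0 when lambda is not an eigenvalue. *)
Definition eig_mult (T : finType) (F : fieldType) (S : signed_graph T)
    (lambda : F) : nat :=
  mup lambda (char_poly (adjacency F S)).

Definition induced_sgraph (T : finType) (G : sgraph T) (X : {set T}) :
     sgraph {x : T | x \in X} :=
  @SGraph {x : T | x \in X} (fun x y => adj G (val x) (val y))
    (fun x y => adj_sym G (val x) (val y)) (fun x => adj_irr G (val x)).

Definition induced (T : finType) (S : signed_graph T) (X : {set T}) :
    signed_graph {x : T | x \in X} :=
  @SignedGraph {x : T | x \in X} (induced_sgraph (ground S) X)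
    (fun x y => sgn S (val x) (val y))
    (fun x y => @sgn_sym T S (val x) (val y))
    (fun x y => @sgn_pm1 T S (val x) (val y)).

Definition contains_neg_edges (T : finType) (S : signed_graph T)
    (X : {set T}) : Prop :=
  forall x y : T, neg_edge S x y ->
    exists x' y' : {x : T | x \in X},
      [/\ val x' = x, val y' = y & neg_edge (induced S X) x' y'].

Definition complete_bipartite (T : finType) (G : sgraph T)
    (U V : {set T}) : Prop :=
  [/\ U :|: V = [set: T], U :&: V = set0 &
      forall x y, adj G x y = (x \in U) && (y \in V) || (x \in V) && (y \in U)].

(* Main.v *)
(* All negative edges join U_r to V_s, so the smaller of these two sets, W,
   covers them.  The adjacency matrix is that of the all-positive K_{p,q}, which
   is a sum of two matrices of rank 1, minus twice the adjacency matrix of the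
   negative edges; the latter is a sum of a matrix supported on the rows in W and
   a matrix supported on the columns in W.  Hence the rank is at most 2|W| + 2,
   and the algebraic multiplicity of 0 is at least the nullity. *)
Require Import Defs.
From mathcomp Require Import all_boot all_order all_algebra.
From mathcomp Require Import zify.

Set Implicit Arguments.
Unset Strict Implicit.
Unset Printing Implicit Defensive.

Import Order.TTheory GRing.Theory Num.Theory.

Local Open Scope ring_scope.

(** Geometric multiplicity is bounded by algebraic multiplicity. Row operations over [F] bring
    [A - a%:M], of rank [r], to a matrix whose last [n - r] rows vanish; applied to ['X - A], they
    let a factor ['X - a%:P] be pulled out of each of these rows of the determinant. *)
Lemma mxrank_eigenspace_le_mup (F : fieldType) (n : nat) (A : 'M[F]_n) (a : F) :
  (\rank (eigenspace A a) <= mup a (char_poly A))%N.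
Proof.
set B := A - a%:M; set r := \rank B.
have -> : \rank (eigenspace A a) = (n - r)%N by rewrite mxrank_ker.
pose C := col_ebase B; pose Q : 'M_n := pid_mx r *m row_ebase B.
have CU : C \in unitmx by exact: col_ebase_unit.
have CB : invmx C *m B = Q.
  by rewrite -[in LHS](mulmx_ebase B) -!mulmxA mulKmx.
pose CP := map_mx (@polyC F) (invmx C).
pose E := ('X - a%:P)%:M - map_mx (@polyC F) B.
have AE : char_poly_mx A = E.
  rewrite /char_poly_mx /E /B map_mxB map_scalar_mx /= raddfB /=.
  by rewrite opprB addrA subrK.
(* The rows of [CP *m E] of index at least [r] are multiples of
   ['X - a%:P]. *)
pose d := \row_(i < n) (if (i < r)%N then 1 else 'X - a%:P) : 'rV[{poly F}]_n.
pose M := \matrix_(i < n, j < n)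
  (if (i < r)%N then (CP *m E) i j else CP i j).
have eqM : CP *m E = diag_mx d *m M.
  apply/matrixP=> i j; rewrite mul_diag_mx; case lt_ir: (i < r)%N; last first.
    (* Here [i >= r], so [pid_mx r] kills row [i] of [Q], and only the scalar part of [E]
       contributes. *)
    rewrite mulmxBr -map_mxM CB mul_mx_scalar !mxE lt_ir big1 ?subr0 // => k _.
    by rewrite !mxE lt_ir andbF mul0r.
  by rewrite [RHS]mxE [d _ _]mxE [M _ _]mxE lt_ir mul1r.
have detM : \det CP * char_poly A = \det (diag_mx d) * \det M.
  by rewrite /char_poly AE -!det_mulmx eqM.
have det_d : \det (diag_mx d) = ('X - a%:P) ^+ (n - r).
  have r_n : (r <= n)%N by exact: rank_leq_row.
  (* The diagonal entries, extended to all of [nat] so that the product can be cut at [r]. *)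
  pose f i := if (i < r)%N then 1 else 'X - a%:P.
  rewrite det_diag (eq_bigr (fun i : 'I_n => f i)); last by move=> i _; rewrite mxE.
  rewrite -(big_mkord xpredT f) (big_cat_nat (leq0n r) r_n) /=.
  rewrite big1_seq ?mul1r => [|i]; last first.
    by rewrite mem_index_iota /f => /= ->.
  rewrite -prodr_const_nat; apply: eq_big_nat => i /andP[le_ri _].
  by rewrite /f ltnNge le_ri.
rewrite mup_geq ?monic_neq0 ?char_poly_monic //.
(* A nonzero constant factor does not affect divisibility in [{poly F}]. *)
have c0 : \det (invmx C) != 0.
  by rewrite -unitfE -unitmxE unitmx_inv.
rewrite -(dvdpZr _ _ c0) -mul_polyC -det_map_mx detM det_d.
exact: dvdp_mulr.
Qed.

Lemma mxrank_le_row_support (F : fieldType) (m n : nat) (X : {set 'I_m})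
    (M : 'M[F]_(m, n)) :
  (forall i j, i \notin X -> M i j = 0) -> (\rank M <= #|X|)%N.
Proof.
move=> M0; pose S := (\sum_(i in X) <<row i M>>)%MS.
have MS : (M <= S)%MS.
  apply/row_subP=> i; case: (boolP (i \in X)) => iX.
    by rewrite (sumsmx_sup i) // genmxE.
  have -> : row i M = 0 by apply/rowP=> j; rewrite !mxE M0.
  exact: sub0mx.
apply: (leq_trans (mxrankS MS)).
rewrite -sum1_card; apply: (leq_trans (mxrank_sum_leqif _)) => /=.
by apply: leq_sum => i _; rewrite genmxE rank_leq_row.
Qed.

Lemma mxrank_outer (F : fieldType) (m n : nat) (f : 'I_m -> F) (g : 'I_n -> F) :
  (\rank (\matrix_(i, j) (f i * g j)%R) <= 1)%N.
Proof.
have -> : \matrix_(i, j) (f i * g j) = (\col_i f i) *m (\row_j g j).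
  by apply/matrixP=> i j; rewrite !mxE big_ord1 !mxE.
exact: leq_trans (mxrankM_maxl _ _) (rank_leq_col _).
Qed.

Lemma mxrank_adjacency_neg_cover (F : fieldType) (T : finType)
    (S : signed_graph T) (U V W : {set T}) :
  complete_bipartite (ground S) U V ->
  (forall x y, neg_edge S x y -> (x \in W) || (y \in W)) ->
  (\rank (adjacency F S) <= (#|W| + #|W|).+2)%N.
Proof.
move=> [_ UV0 adjE] covW.
pose e (i : 'I_#|T|) : T := enum_val i.
pose ind (X : {set T}) i : F := (e i \in X)%:R.
pose K X Y := \matrix_(i, j) (ind X i * ind Y j) : 'M[F]_#|T|.
(* The correction [-2] turns an entry [1] into [-1]. [N true] takes the negative edges whose row
   lies in [W]; for those left to [N false], the covering property puts the column in [W], whence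
   the transpose in [rkN2]. *)
pose N (b : bool) := \matrix_(i, j)
  (if neg_edge S (e i) (e j) && ((e i \in W) == b) then - 2%:R else 0) : 'M[F]_#|T|.
have splitN (c : int) (w : bool) : c = -1 \/ c = 1 ->
    c%:~R = 1 + (if (c == -1) && (w == true) then - 2%:R else 0)
              + (if (c == -1) && (w == false) then - 2%:R else 0) :> F.
  case=> -> /=; last by rewrite !addr0.
  by case: w; rewrite /= addr0 (natrD _ 1 1) opprD ?addr0 addrA subrr add0r.
have -> : adjacency F S = K U V + K V U + N true + N false.
  apply/matrixP=> i j; rewrite !mxE /neg_edge /ind adjE -/(e i) -/(e j).
  have disj x : x \in U -> x \in V -> false.
    by move=> xU xV; have := in_set0 x; rewrite -UV0 inE xU xV.
  have := @sgn_pm1 _ S (e i) (e j).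
  move: (disj (e i)) (disj (e j)); rewrite adjE.
  (* Disjointness of [U] and [V] excludes the cases with a vertex in both; in particular [K U V] and
     [K V U] never overlap. *)
  case: (e i \in U); case: (e j \in V); case: (e i \in V); case: (e j \in U) => /= d1 d2 sg;
    try (by have := d1 isT isT); try (by have := d2 isT isT);
    rewrite ?mulr1 ?mulr0 ?mul0r ?addr0 ?add0r //; exact: splitN (sg isT).
have cardW : #|e @^-1: W| = #|W|.
  by rewrite on_card_preimset //; apply: onW_bij; exact: enum_val_bij.
have rkN1 : (\rank (N true) <= #|W|)%N.
  rewrite -cardW; apply: mxrank_le_row_support => i j.
  by rewrite !inE !mxE => /negbTE ->; rewrite andbF.
have rkN2 : (\rank (N false) <= #|W|)%N.
  rewrite -cardW -mxrank_tr; apply: mxrank_le_row_support => i j.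
  rewrite !inE !mxE => niW; case: ifP => // /andP[/covW].
  by rewrite (negbTE niW) orbF => ->.
have rkD (A B : 'M[F]_#|T|) a b : (\rank A <= a)%N -> (\rank B <= b)%N ->
    (\rank (A + B)%R <= a + b)%N.
  by move=> Aa Bb; apply: leq_trans (mxrank_add _ _) (leq_add Aa Bb).
have := rkD _ _ _ _ (rkD _ _ _ _ (rkD _ _ _ _ (mxrank_outer (ind U) (ind V))
  (mxrank_outer (ind V) (ind U))) rkN1) rkN2.
by rewrite -addnA !addSn.
Qed.

Theorem theorem3p1 (R : rcfType) (T : finType) (S : signed_graph T)
    (p q r s : nat) (Up Vq Ur Vs : {set T})
    (le_pq : (p <= q)%N)
    (bipS : complete_bipartite (ground S) Up Vq)
    (card_Up : #|Up| = p) (card_Vq : #|Vq| = q)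
    (sub_Ur : Ur \subset Up) (sub_Vs : Vs \subset Vq)
    (card_Ur : #|Ur| = r) (card_Vs : #|Vs| = s)
    (neg_UrVs : contains_neg_edges S (Ur :|: Vs))
    (min_rs : forall U V : {set T}, U \subset Up -> V \subset Vq ->
       contains_neg_edges S (U :|: V) -> (r + s <= #|U| + #|V|)%N) :
  p%:Z + q%:Z - 2 * (minn r s)%:Z - 2 <= (eig_mult S (0 : R))%:Z.
Proof.
have [UV_T UV0 adjE] := bipS.
have cardT : #|T| = (p + q)%N.
  by rewrite -cardsT -UV_T cardsU UV0 cards0 subn0 card_Up card_Vq.
have disj x : x \in Up -> x \in Vq -> false.
  by move=> xU xV; have := in_set0 x; rewrite -UV0 inE xU xV.
(* A negative edge has both ends in [Ur :|: Vs] and joins opposite parts, so it has one end in [Ur]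
   and one in [Vs]: each of the two sets is a cover by itself. *)
have cov x y : neg_edge S x y ->
    ((x \in Ur) || (y \in Ur)) && ((x \in Vs) || (y \in Vs)).
  move=> nxy; have [[x' x'P] [[y' y'P] [/= xx yy _]]] := neg_UrVs _ _ nxy.
  move: x'P y'P; rewrite {}xx {}yy !inE.
  move: nxy => /andP[]; rewrite adjE => axy _ /orP[xU|xV] /orP[yU|yV].
  - rewrite xU; have xUp := subsetP sub_Ur _ xU; have yUp := subsetP sub_Ur _ yU.
    by case/orP: axy => /andP[a b]; [have := disj y yUp b | have := disj x xUp a].
  - by rewrite xU yV orbT.
  - by rewrite xV yU orbT.
  - have xVq := subsetP sub_Vs _ xV; have yVq := subsetP sub_Vs _ yV.
    by case/orP: axy => /andP[a b]; [have := disj x a xVq | have := disj y b yVq].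
have rk : (\rank (adjacency R S) <= (minn r s + minn r s).+2)%N.
  have covU := mxrank_adjacency_neg_cover R (W := Ur) bipS
    (fun x y nxy => proj1 (andP (cov x y nxy))).
  have covV := mxrank_adjacency_neg_cover R (W := Vs) bipS
    (fun x y nxy => proj2 (andP (cov x y nxy))).
  by rewrite card_Ur in covU; rewrite card_Vs in covV; case: (leqP r s).
have := mxrank_eigenspace_le_mup (adjacency R S) 0.
rewrite /eigenspace raddf0 subr0 mxrank_ker -/(eig_mult S 0).
(* The nullity [p + q - k] is a truncated difference, which is at least the integer one, so the
   bound on [k] transfers. *)
move: rk; move: (\rank _) => k; rewrite cardT; move: (eig_mult S _) (minn r s) => m w; lia.
Qed.
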